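(* Let $G=(A,B,E)$ be a balanced bipartite graph with $2n$ vertices and let $X$ be its reduced adjacency matrix. Then $G$ is $\alpha$-stable if and only if there exist permutation matrices $P,Q$ of order $n$ and an integer $k\geq 1$ such that $$PXQ=\begin{bmatrix} X_1 & X_{12} & X_{13} & \cdots & X_{1k}\\ O & X_2 & X_{23} & \cdots & X_{2k}\\ \vdots & & \ddots & & \vdots\\ O & O & \cdots & O & X_k\end{bmatrix},$$ where $X_1,\dots,X_k$ are square fully indecomposable matrices each of order at least $2$, the blocks $O$ below the diagonal are zero matrices, and the blocks $X_{ij}$ ($i<j$) are arbitrary $(0,1)$-matrices.
   Context: All graphs are finite and simple. For a graph $G$, $\alpha(G)$ denotes the largest cardinality of a stable set (set of pairwise nonadjacent vertices). $G$ is $\alpha^-$-stable if $\alpha(G-e)=\alpha(G)$ for every edge $e$ of $G$; $\alpha^+$-stable if $\alpha(G+e)=\alpha(G)$ for every pair $e=xy$ of distinct nonadjacent vertices; $\alpha$-stable if it is both $\alpha^-$-stable and $\alpha^+$-stable. A bipartite graph $G=(A,B,E)$ is balanced if $|A|=|B|$. With $A=\{a_1,\dots,a_n\}$, $B=\{b_1,\dots,b_n\}$, the reduced adjacency matrix is $X=[x_{ij}]$ with $x_{ij}=1$ iff $a_ib_j\in E$, else $0$. A square $(0,1)$-matrix of order $r$ is partly decomposable if either $r=1$ and its entry is $0$, or $r>1$ and it has a $k\times(r-k)$ zero submatrix for some $1\leq k\leq r-1$; otherwise it is fully indecomposable. *)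

(* Defs.v *)
From HB Require Import structures.
From mathcomp Require Import all_boot all_order all_fingroup all_algebra.

Set Implicit Arguments.
Unset Strict Implicit.
Unset Printing Implicit Defensive.

Import GRing.Theory.
Local Open Scope ring_scope.

Section Graphs.

Variable V : finType.
Implicit Types (e : rel V) (A B S : {set V}) (x y : V).

Definition simple_graph e := symmetric e /\ irreflexive e.

Definition stable e S := [forall x in S, forall y in S, ~~ e x y].

Definition alpha e : nat := (\max_(S : {set V} | stable e S) #|S|)%N.

Definition del_edge e x y : rel V :=
  [rel u v | e u v && ([set u; v] != [set x; y])].

(* For x = y this would add a loop; it is only used with x != y. *)
Definition add_edge e x y : rel V :=
  [rel u v | e u v || ([set u; v] == [set x; y])].

Definition alpha_minus_stable e :=
  forall x y, e x y -> alpha (del_edge e x y) = alpha e.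

Definition alpha_plus_stable e :=
  forall x y, x != y -> ~~ e x y -> alpha (add_edge e x y) = alpha e.

Definition alpha_stable e := alpha_minus_stable e /\ alpha_plus_stable e.

Definition bipartition e A B :=
  [/\ A :&: B = set0, A :|: B = [set: V] &
      forall x y, e x y ->
        (x \in A) && (y \in B) || (x \in B) && (y \in A)].

(* a lists the elements of A without repetition: A = {a_0, ..., a_(n-1)}. *)
Definition enumerates n (a : 'I_n -> V) A :=
  injective a /\ [set a i | i in 'I_n] = A.

Definition reduced_adjacency e n (a b : 'I_n -> V) : 'M[int]_n :=
  \matrix_(i, j) (e (a i) (b j))%:R.

Lemma del_edge_simple e x y : simple_graph e -> simple_graph (del_edge e x y).
Proof.
by move=> [es ei]; split=> [u v | u]; rewrite /del_edge /= ?ei // es setUC.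
Qed.

Lemma add_edge_simple e x y :
  x != y -> simple_graph e -> simple_graph (add_edge e x y).
Proof.
move=> xy [es ei]; split=> [u v | u]; rewrite /add_edge /=.
  by rewrite es setUC.
rewrite ei /=; apply/eqP => /(congr1 (fun S : {set V} => #|S|)).
by rewrite !cards2 eqxx xy.
Qed.

End Graphs.

Definition zero_one_mx m n (M : 'M[int]_(m, n)) :=
  forall i j, M i j = 0 \/ M i j = 1.

(* A submatrix is given by its set I of rows and its set J of columns. *)
Definition has_zero_submx m n (M : 'M[int]_(m, n)) (p q : nat) :=
  exists (I : {set 'I_m}) (J : {set 'I_n}),
    [/\ #|I| = p, #|J| = q & forall i j, i \in I -> j \in J -> M i j = 0].

Definition partly_decomposable r (M : 'M[int]_r) :=
  (r = 1%N /\ forall i j, M i j = 0) \/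
  ((1 < r)%N /\
   exists k : nat, (1 <= k <= r - 1)%N /\ has_zero_submx M k (r - k)).

Definition fully_indecomposable r (M : 'M[int]_r) :=
  zero_one_mx M /\ ~ partly_decomposable M.

(* Main.v *)
(** A stable set of [G] is a zero submatrix I x J of [X], of size |I| + |J|.

    If alpha(G) > n, the lattice structure of the maximum stable sets gives a
    vertex of [A] and a vertex of [B] lying in all of them, and joining these
    two lowers alpha. Hence [G] is alpha-stable iff alpha(G) = alpha(G - e) = n
    for every edge [e], i.e. iff every I x J containing at most one nonzero
    entry of [X] satisfies |I| + |J| <= n ([robust] below).

    Robustness passes to the two diagonal blocks cut out by a zero submatrix
    with |I| + |J| = n, so splitting as long as possible yields the block
    triangular form; order-one blocks cannot occur, since a 1 x 1 matrix has at
    most one nonzero entry. Conversely, a fully indecomposable block of order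
    at least two is robust, and summing over the blocks bounds |I| + |J|. *)

Require Import Defs.
From HB Require Import structures.
From mathcomp Require Import all_boot all_order all_fingroup all_algebra.
From mathcomp Require Import zify.

Set Implicit Arguments.
Unset Strict Implicit.
Unset Printing Implicit Defensive.

Import GRing.Theory.
Local Open Scope ring_scope.

Lemma exists_subset_card (T : finType) (S : {set T}) m :
  (m <= #|S|)%N -> exists2 S' : {set T}, S' \subset S & #|S'| = m.
Proof.
case/card_geqP=> s [us <- sS]; exists [set x in s].
  by apply/subsetP => x; rewrite inE => /sS.
by rewrite cardsE; apply/card_uniqP.
Qed.

(** * Zero patterns, robustness and diagonal levels *)

Section Patterns.

Variables T U : finType.
Implicit Types (x : T -> U -> bool) (I R : {set T}) (J C : {set U}).

Definition zero_on x I J := [forall i in I, forall j in J, ~~ x i j].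

Definition sparse_on x I J := forall i j i' j',
  i \in I -> j \in J -> i' \in I -> j' \in J ->
  x i j -> x i' j' -> i = i' /\ j = j'.

(** Working with [R] and [C] inside fixed index types lets the splitting induction descend to
    diagonal blocks without renumbering. *)
Definition robust x R C := forall I J,
  I \subset R -> J \subset C -> sparse_on x I J -> (#|I| + #|J| <= #|R|)%N.

(** For [#|R| = #|C|] this is full indecomposability of the block; at order one it forces the only
    entry to be nonzero. *)
Definition indecomposable x R C := forall I J,
  I \subset R -> J \subset C -> I != set0 -> J != set0 ->
  zero_on x I J -> (#|I| + #|J| < #|R|)%N.

Lemma zero_onP x I J :
  reflect (forall i j, i \in I -> j \in J -> ~~ x i j) (zero_on x I J).
Proof.
apply: (iffP 'forall_implyP) => [z i j iI jJ | z i iI].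
  by move/forall_inP: (z i iI); exact.
by apply/forall_inP => j; exact: z.
Qed.

Lemma zero_on_sparse x I J : zero_on x I J -> sparse_on x I J.
Proof. by move/zero_onP=> z i j i' j' iI jJ _ _; rewrite (negPf (z i j iI jJ)). Qed.

Lemma indecomposable_robust x R C :
  #|R| = #|C| -> (1 < #|R|)%N -> indecomposable x R C -> robust x R C.
Proof.
move=> cRC R1 ind I J IR JC sp.
have leI := subset_leq_card IR; have leJ := subset_leq_card JC.
have [->|I0] := eqVneq I set0; first by rewrite cards0; lia.
have [->|J0] := eqVneq J set0; first by rewrite cards0; lia.
have [z|/zero_onP nz] := boolP (zero_on x I J); first exact/ltnW/ind.
have [i [j [iI jJ xij]]] : exists i j, [/\ i \in I, j \in J & x i j].
  case: (boolP [exists i in I, exists j in J, x i j]).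
    by case/exists_inP=> i iI /exists_inP[j jJ xij]; exists i, j.
  move=> h; case: nz => i j iI jJ; apply: contra h => xij.
  by apply/exists_inP; exists i => //; apply/exists_inP; exists j.
have Ii := cardsD1 i I; have Jj := cardsD1 j J; rewrite iI jJ /= in Ii Jj.
have [Ii0|Ii0] := eqVneq (I :\ i) set0; last first.
  suff: (#|I :\ i| + #|J| < #|R|)%N by lia.
  apply: ind => //; first by rewrite (subset_trans _ IR) ?subD1set.
  apply/zero_onP => i' j'; rewrite !inE => /andP[ii' i'I] j'J.
  by apply: contra ii' => xij'; have [-> _] := sp _ _ _ _ i'I j'J iI jJ xij' xij.
have [Jj0|Jj0] := eqVneq (J :\ j) set0; last first.
  suff: (#|I| + #|J :\ j| < #|R|)%N by lia.
  apply: ind => //; first by rewrite (subset_trans _ JC) ?subD1set.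
  apply/zero_onP => i' j' i'I; rewrite !inE => /andP[jj' j'J].
  by apply: contra jj' => xij'; have [_ ->] := sp _ _ _ _ i'I j'J iI jJ xij' xij.
by move: Ii Jj; rewrite Ii0 Jj0 !cards0; lia.
Qed.

(* Level [t] of [f] and of [g] are the rows and columns of the [t]-th diagonal
   block; the levels outside [0, k) are irrelevant. *)
Definition block_levels x R C k (f : T -> nat) (g : U -> nat) :=
  [/\ {in R, forall i, f i < k}%N, {in C, forall j, g j < k}%N,
      {in R & C, forall i j, (g j < f i)%N -> ~~ x i j} &
      forall t, (t < k)%N ->
        [/\ #|[set i in R | f i == t]| = #|[set j in C | g j == t]|,
            (1 < #|[set i in R | f i == t]|)%N &
            indecomposable x [set i in R | f i == t] [set j in C | g j == t]]].

(** The second family of blocks is placed after the first by shifting its levels by [k1]; the zero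
    corner [R2] x [C1] is then the part below the diagonal where the two families meet. *)
Lemma block_levels_cat x R1 R2 C1 C2 k1 k2 f1 g1 f2 g2 :
  [disjoint R1 & R2] -> [disjoint C1 & C2] -> zero_on x R2 C1 ->
  block_levels x R1 C1 k1 f1 g1 -> block_levels x R2 C2 k2 f2 g2 ->
  block_levels x (R1 :|: R2) (C1 :|: C2) (k1 + k2)
    (fun i => if i \in R1 then f1 i else k1 + f2 i)%N
    (fun j => if j \in C1 then g1 j else k1 + g2 j)%N.
Proof.
move=> dR dC /zero_onP z [f1k g1k z1 b1] [f2k g2k z2 b2].
have nR1 i : i \in R2 -> i \in R1 = false by apply: disjointFl.
have nC1 j : j \in C2 -> j \in C1 = false by apply: disjointFl.
split.
- move=> i; rewrite inE; have [iR1 _|_ /= iR2] := boolP (i \in R1).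
    by rewrite ltn_addr ?f1k.
  by rewrite ltn_add2l f2k.
- move=> j; rewrite inE; have [jC1 _|_ /= jC2] := boolP (j \in C1).
    by rewrite ltn_addr ?g1k.
  by rewrite ltn_add2l g2k.
- move=> i j; rewrite !inE.
  have [iR1 _|_ /= iR2] := boolP (i \in R1);
    have [jC1 _|_ /= jC2] := boolP (j \in C1).
  + exact: z1.
  + by have := f1k i iR1; lia.
  + by move=> _; apply: z.
  + by rewrite ltn_add2l; apply: z2.
move=> t lt_t; have [t1|t1] := ltnP t k1.
  suff [-> ->] : [set i in R1 :|: R2 | (if i \in R1 then f1 i else k1 + f2 i)%N == t]
      = [set i in R1 | f1 i == t] /\
    [set j in C1 :|: C2 | (if j \in C1 then g1 j else k1 + g2 j)%N == t]
      = [set j in C1 | g1 j == t] by exact: b1.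
  by split; apply/setP => i; rewrite !inE; case: (i \in _) => //=;
    case: (i \in _) => //=; lia.
suff [-> ->] : [set i in R1 :|: R2 | (if i \in R1 then f1 i else k1 + f2 i)%N == t]
    = [set i in R2 | f2 i == (t - k1)%N] /\
  [set j in C1 :|: C2 | (if j \in C1 then g1 j else k1 + g2 j)%N == t]
    = [set j in C2 | g2 j == (t - k1)%N] by apply: b2; lia.
split; apply/setP => i; rewrite !inE.
  have [iR1|_] /= := boolP (i \in R1); last by congr (_ && _); lia.
  by rewrite (disjointFr dR) //=; have := f1k i iR1; lia.
have [iC1|_] /= := boolP (i \in C1); last by congr (_ && _); lia.
by rewrite (disjointFr dC) //=; have := g1k i iC1; lia.
Qed.

(** Since [I] x [L] is zero, adding the rows [I] to a sparse [K] x [L] keeps it sparse; robustness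
    of the whole then bounds [#|I| + #|K| + #|L|] by [#|R|]. *)
Lemma robust_upper x R C I J :
  #|R| = #|C| -> I \subset R -> J \subset C -> zero_on x I J ->
  (#|I| + #|J| = #|R|)%N -> robust x R C -> robust x (R :\: I) J.
Proof.
move=> cRC IR JC /zero_onP z cIJ rob K L KR LJ sp.
have dIK : [disjoint I & K].
  rewrite disjoint_sym; apply: disjointWl KR _.
  by rewrite -setI_eq0 setIDAC setDIl setDv setI0.
suff: (#|I :|: K| + #|L| <= #|R|)%N.
  by rewrite cardsU disjoint_setI0 // cards0 cardsD (setIidPr IR); lia.
apply: rob; first by rewrite subUset IR (subset_trans KR) ?subsetDl.
  exact: subset_trans LJ JC.
move=> i j i' j'; rewrite !inE => iIK jL i'IK j'L xij xij'.
have jJ := subsetP LJ _ jL; have j'J := subsetP LJ _ j'L.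
case/orP: iIK xij => [iI|iK] xij; first by rewrite (negPf (z i j iI jJ)) in xij.
case/orP: i'IK xij' => [iI|i'K] xij'; last exact: sp xij xij'.
by rewrite (negPf (z _ _ iI j'J)) in xij'.
Qed.

(** Dual to [robust_upper]: the columns [J] are added to [L], and [#|R| - #|J|] is the order [#|I|]
    of the block. *)
Lemma robust_lower x R C I J :
  #|R| = #|C| -> I \subset R -> J \subset C -> zero_on x I J ->
  (#|I| + #|J| = #|R|)%N -> robust x R C -> robust x I (C :\: J).
Proof.
move=> cRC IR JC /zero_onP z cIJ rob K L KI LC sp.
have dJL : [disjoint J & L].
  rewrite disjoint_sym; apply: disjointWl LC _.
  by rewrite -setI_eq0 setIDAC setDIl setDv setI0.
suff: (#|K| + #|J :|: L| <= #|R|)%N.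
  by rewrite cardsU disjoint_setI0 // cards0; lia.
apply: rob; first exact: subset_trans KI IR.
  by rewrite subUset JC (subset_trans LC) ?subsetDl.
move=> i j i' j'; rewrite !inE => iK jJL i'K j'JL xij xij'.
have iI := subsetP KI _ iK; have i'I := subsetP KI _ i'K.
case/orP: jJL xij => [jJ|jL] xij; first by rewrite (negPf (z i j iI jJ)) in xij.
case/orP: j'JL xij' => [j'J|j'L] xij'; last exact: sp xij xij'.
by rewrite (negPf (z _ _ i'I j'J)) in xij'.
Qed.

(* A zero submatrix with |I| + |J| = |R| splits the matrix into the two square
   diagonal blocks (R \ I) x J and I x (C \ J), both of which stay robust. *)
Lemma robust_block_levels x R C :
  #|R| = #|C| -> (0 < #|R|)%N -> robust x R C ->
  exists k f g, (0 < k)%N /\ block_levels x R C k f g.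
Proof.
have [m] := ubnP #|R|; elim: m R C => // m IHm R C ltRm cRC R0 rob.
have [/existsP[I /existsP[J /and5P[IR JC I0 J0 /andP[z leR]]]]|h] := boolP
  [exists I : {set T}, exists J : {set U},
    [&& I \subset R, J \subset C, I != set0, J != set0,
        zero_on x I J & #|R| <= #|I| + #|J|]]%N.
  (* Robustness turns a violation of indecomposability into an equality, which makes both diagonal
     blocks square. *)
  have cIJ : (#|I| + #|J| = #|R|)%N.
    by apply/eqP; rewrite eqn_leq leR andbT rob //; apply: zero_on_sparse.
  rewrite -!card_gt0 in I0 J0.
  have cRI : #|R :\: I| = #|J| by rewrite cardsD (setIidPr IR); lia.
  have cCJ : #|C :\: J| = #|I| by rewrite cardsD (setIidPr JC); lia.
  have [||||k1 [f1 [g1 [k1_gt0 b1]]]] := IHm (R :\: I) J; try lia.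
    exact: robust_upper cIJ rob.
  have [||||k2 [f2 [g2 [k2_gt0 b2]]]] := IHm I (C :\: J); try lia.
    exact: robust_lower cIJ rob.
  have eR : R = (R :\: I) :|: I.
    by rewrite -{1}(setID R I) setUC (setIidPr IR).
  have eC : C = J :|: (C :\: J) by rewrite -{1}(setID C J) (setIidPr JC).
  (* The block [R :\: I] x [J] comes first, so that the zero submatrix [I] x [J] lies below the
     diagonal. *)
  rewrite eR eC; do 3!eexists; split; last first.
  - apply: block_levels_cat b1 b2 => //.
      by rewrite -setI_eq0 setIDAC setDIl setDv setI0.
    by rewrite disjoint_sym -setI_eq0 setIDAC setDIl setDv setI0.
  - lia.
have R1 : (1 < #|R|)%N.
  rewrite ltnNge; apply/negP => leR1; have R1 : #|R| = 1%N by lia.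
  have /cards1P[i Ri] : #|R| == 1%N by rewrite R1.
  have /cards1P[j Cj] : #|C| == 1%N by rewrite -cRC R1.
  suff: (#|R| + #|C| <= #|R|)%N by lia.
  apply: rob => //.
  by rewrite Ri Cj => ? ? ? ?; rewrite !inE => /eqP-> /eqP-> /eqP-> /eqP->.
have ind : indecomposable x R C.
  move=> I J IR JC I0 J0 z; rewrite ltnNge; apply: contra h => leR.
  by apply/existsP; exists I; apply/existsP; exists J; apply/and5P; split;
    rewrite ?z.
exists 1%N, (fun=> 0%N), (fun=> 0%N); split=> //; split=> // -[|//] _.
suff [-> ->]: [set i in R | 0 == 0]%N = R /\ [set j in C | 0 == 0]%N = C by [].
by split; apply/setP => i; rewrite !inE andbT.
Qed.

Lemma card_levels (S : finType) (K : {set S}) k (f : S -> nat) :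
  {in K, forall i, f i < k}%N ->
  #|K| = (\sum_(t < k) #|[set i in K | f i == t]|)%N.
Proof.
move=> fk; rewrite -sum1_card.
transitivity (\sum_(i in K) \sum_(t < k | f i == t) 1)%N.
  apply: eq_bigr => i iK.
  by rewrite (big_pred1 (Ordinal (fk i iK))).
rewrite (exchange_big_dep predT) //=; apply: eq_bigr => t _.
by rewrite -sum1_card; apply: eq_bigl => i; rewrite inE.
Qed.

(** Cutting [I] and [J] down to level [t] leaves a sparse submatrix of the [t]-th diagonal block, so
    the bound holds level by level and adds up. *)
Lemma block_levels_robust x R C k f g : block_levels x R C k f g -> robust x R C.
Proof.
move=> [fk gk _ bl] I J IR JC sp.
rewrite (card_levels fk) (@card_levels _ I k f) => [|i /(subsetP IR)]; last exact: fk.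
rewrite (@card_levels _ J k g) => [|j /(subsetP JC)]; last exact: gk.
rewrite -big_split; apply: leq_sum => t _ /=.
have [cRC R1 ind] := bl t (ltn_ord t).
apply: (indecomposable_robust cRC R1 ind).
- by apply/subsetP => i; rewrite !inE => /andP[/(subsetP IR) -> ->].
- by apply/subsetP => j; rewrite !inE => /andP[/(subsetP JC) -> ->].
by move=> i j i' j'; rewrite !inE => /andP[? _] /andP[? _] /andP[? _] /andP[? _];
  apply: sp.
Qed.

End Patterns.

(** * Blocks as index sets versus blocks as matrices *)

Lemma indecomposable_preim (T U T' U' : finType) (phi : T' -> T) (psi : U' -> U)
    (x : T -> U -> bool) :
  injective phi -> injective psi ->
  indecomposable (fun p q => x (phi p) (psi q)) setT setT <->
  indecomposable x [set phi p | p in T'] [set psi q | q in U'].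
Proof.
move=> phiI psiI; rewrite /indecomposable card_imset //; split=> ind I J.
  move=> IR JC I0 J0 /zero_onP z.
  have eI : I = phi @: (phi @^-1: I).
    apply/setP => i; apply/idP/imsetP => [iI|[p]]; last by rewrite inE => ? ->.
    by have /imsetP[p _ ip] := subsetP IR i iI; exists p; rewrite ?inE -?ip.
  have eJ : J = psi @: (psi @^-1: J).
    apply/setP => j; apply/idP/imsetP => [jJ|[q]]; last by rewrite inE => ? ->.
    by have /imsetP[q _ jq] := subsetP JC j jJ; exists q; rewrite ?inE -?jq.
  rewrite eI eJ !card_imset // -cardsT; apply: ind; rewrite ?subsetT //.
  - by apply: contraNneq I0 => I0; rewrite eI I0 imset0.
  - by apply: contraNneq J0 => J0; rewrite eJ J0 imset0.
  by apply/zero_onP => p q; rewrite !inE; apply: z.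
move=> _ _ I0 J0 /zero_onP z; rewrite cardsT.
rewrite -(card_imset I phiI) -(card_imset J psiI); apply: ind.
- exact/imsetS/subset_predT.
- exact/imsetS/subset_predT.
- by rewrite imset_eq0.
- by rewrite imset_eq0.
by apply/zero_onP => _ _ /imsetP[p pI ->] /imsetP[q qJ ->]; apply: z.
Qed.

Lemma fully_indecomposableP r (M : 'M[int]_r) (m : 'I_r -> 'I_r -> bool) :
  (1 < r)%N -> (forall p q, M p q = (m p q)%:R) ->
  fully_indecomposable M <-> indecomposable m setT setT.
Proof.
move=> r1 Mm; split=> [[_ ndec] I J _ _ I0 J0 /zero_onP z | ind].
  rewrite cardsT card_ord ltnNge; apply/negP => leIJ; apply: ndec; right; split=> //.
  rewrite -!card_gt0 in I0 J0.
  (* The cap [r.-1] keeps [r - k] positive when [I] consists of all rows. In both cases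
     [r - k <= #|J|]: by [leIJ] if [k = #|I|], and because [J] is nonempty if [k = r.-1]. *)
  pose k := minn #|I| r.-1.
  have [|I' I'I cI'] := @exists_subset_card _ I k; first lia.
  have [|J' J'J cJ'] := @exists_subset_card _ J (r - k); first lia.
  exists k; split; first lia.
  exists I', J'; split=> // i j /(subsetP I'I) iI /(subsetP J'J) jJ.
  by rewrite Mm (negPf (z i j iI jJ)).
split=> [i j|]; first by rewrite Mm; case: (m i j); [right | left].
case=> [[r_1 _]|[_ [k [kr [I [J [cI cJ z]]]]]]]; first by rewrite r_1 in r1.
have: (#|I| + #|J| < #|[set: 'I_r]|)%N.
  apply: ind; rewrite ?subsetT -?card_gt0 ?cI ?cJ //; [lia.. |].
  apply/zero_onP => i j iI jJ; apply/negP => mij.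
  by have := z i j iI jJ; rewrite Mm mij.
by rewrite cardsT card_ord cI cJ; lia.
Qed.

Definition block_triangular n (X : 'M[int]_n) :=
  exists P Q : 'M[int]_n, is_perm_mx P /\ is_perm_mx Q /\
  exists k : nat, (1 <= k)%N /\
  exists (r : 'I_k -> nat) (sum_r : (\sum_(i < k) r i)%N = n)
         (Y : forall i j : 'I_k, 'M[int]_(r i, r j)),
    [/\ P *m X *m Q = castmx (sum_r, sum_r) (\mxblock_(i < k, j < k) Y i j),
        forall i : 'I_k, (2 <= r i)%N /\ fully_indecomposable (Y i i),
        forall i j : 'I_k, (j < i)%N -> Y i j = 0 &
        forall i j : 'I_k, (i < j)%N -> zero_one_mx (Y i j)].

Lemma perm_mx_mul_entry n (X : 'M[int]_n) (s t : 'S_n) i j :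
  (perm_mx s *m X *m perm_mx t) i j = X (s i) ((t^-1)%g j).
Proof. by rewrite -{1}[t]invgK -col_permE -row_permE !mxE. Qed.

(** * From a block triangular form to levels *)

Section BlockIndex.

Variables (n k : nat) (r : 'I_k -> nat) (sum_r : (\sum_(i < k) r i)%N = n).
Variable s : 'S_n.

(** The line of the original matrix that [s] brings to position [p] of block [t]; [tagnat.Rank] is
    that position counted across all blocks. *)
Definition block_index t (p : 'I_(r t)) : 'I_n :=
  s (cast_ord sum_r (tagnat.Rank _ p)).

Definition block_of i : 'I_k := tagnat.sig1 (cast_ord (esym sum_r) ((s^-1)%g i)).

Lemma block_index_inj t : injective (@block_index t).
Proof.
move=> p q /perm_inj /cast_ord_inj /(congr1 val) /eqP.
by rewrite tagnat.eq_Rank eqxx => /eqP/val_inj.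
Qed.

Lemma block_indexK t (p : 'I_(r t)) : block_of (block_index p) = t.
Proof. by rewrite /block_of permK cast_ordK tagnat.Rank1K. Qed.

Lemma block_index_surj i : exists p : 'I_(r (block_of i)), i = block_index p.
Proof.
exists (tagnat.sig2 (cast_ord (esym sum_r) ((s^-1)%g i))).
by rewrite /block_index tagnat.sig2K cast_ordKV permKV.
Qed.

Lemma block_index_image t :
  [set block_index p | p in 'I_(r t)] = [set i | block_of i == t].
Proof.
apply/setP => i; rewrite inE; apply/imsetP/eqP => [[p _ ->]|<-].
  exact: block_indexK.
by have [p ip] := block_index_surj i; exists p.
Qed.

End BlockIndex.

Lemma block_triangular_levels n (x : 'I_n -> 'I_n -> bool) :
  block_triangular (\matrix_(i, j) (x i j)%:R) ->
  exists k f g, block_levels x setT setT k f g.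
Proof.
case=> _ [_ [/is_perm_mxP[s ->] [/is_perm_mxP[t ->] [k [_ [r [sum_r [Y]]]]]]]].
move=> [eY diagY lowY _].
pose phi u := @block_index n k r sum_r s u.
(* Multiplication on the right by [perm_mx t] puts column [t^-1 j] at position [j], hence the
   inverse. *)
pose psi u := @block_index n k r sum_r t^-1%g u.
pose f := block_of sum_r s; pose g := block_of sum_r t^-1%g.
(* Reading the block equation entrywise; through it the conditions on [Y] become conditions on
   [x]. *)
have xY u v p q : Y u v p q = (x (phi u p) (psi v q))%:R.
  rewrite -{1}(mxblockK Y u v) mxE.
  have := congr1 (fun M : 'M_n => M (cast_ord sum_r (tagnat.Rank _ p))
                                  (cast_ord sum_r (tagnat.Rank _ q))) eY.
  by rewrite perm_mx_mul_entry castmxE !cast_ordK mxE => <-.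
exists k, f, g; split.
- by move=> i _; apply: ltn_ord.
- by move=> i _; apply: ltn_ord.
- move=> i j _ _; rewrite /f /g => lt_gf.
  have [p ip] := block_index_surj sum_r s i.
  have [q jq] := block_index_surj sum_r t^-1%g j.
  have := xY _ _ p q; rewrite lowY // mxE /phi /psi -ip -jq.
  by case: (x i j).
move=> u0 ltuk; pose u := Ordinal ltuk.
have -> : [set i in setT | f i == u0 :> nat] = [set phi u p | p in 'I_(r u)].
  by rewrite block_index_image; apply/setP => i; rewrite !inE.
have -> : [set i in setT | g i == u0 :> nat] = [set psi u p | p in 'I_(r u)].
  by rewrite block_index_image; apply/setP => i; rewrite !inE.
have phiI : injective (phi u) := @block_index_inj _ _ _ _ _ _.
have psiI : injective (psi u) := @block_index_inj _ _ _ _ _ _.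
have [r2 indY] := diagY u.
rewrite !card_imset // !card_ord; split=> //.
apply/indecomposable_preim => //.
exact/(fully_indecomposableP r2 (xY u u)).
Qed.

(** * From levels to a block triangular form *)

Section LevelEnumeration.

Variables (n k : nat) (f : 'I_n -> 'I_k) (r : 'I_k -> nat).
Hypothesis card_f : forall t, r t = #|[set i | f i == t]|.

(** The sizes [r] are given up to the equation [card_f], so that row levels and column levels of
    equal size are indexed by the same type. *)
Definition level_index t (p : 'I_(r t)) : 'I_n :=
  enum_val (cast_ord (card_f t) p).

Lemma level_index_inj t : injective (@level_index t).
Proof. by move=> p q /enum_val_inj /cast_ord_inj. Qed.

Lemma level_indexK t (p : 'I_(r t)) : f (level_index p) = t.
Proof. by have := enum_valP (cast_ord (card_f t) p); rewrite inE => /eqP. Qed.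

Lemma level_index_image t :
  [set level_index p | p in 'I_(r t)] = [set i | f i == t].
Proof.
apply/eqP; rewrite eqEcard card_imset ?card_ord -?card_f ?leqnn ?andbT //; last first.
  exact: level_index_inj.
by apply/subsetP => _ /imsetP[p _ ->]; rewrite inE level_indexK.
Qed.

Lemma level_sum : (\sum_(t < k) r t)%N = n.
Proof.
rewrite -[RHS]card_ord -cardsT (@card_levels _ setT k f) //.
apply: eq_bigr => t _; rewrite card_f.
by apply: eq_card => i; rewrite !inE.
Qed.

(** Listing the levels one after another is an injective map from ['I_n] to itself, hence a
    permutation. *)
Lemma level_perm : exists s : 'S_n, forall u,
  s (cast_ord level_sum u) = level_index (tagnat.sig2 u).
Proof.
pose h u := level_index (tagnat.sig2 (cast_ord (esym level_sum) u)).
have hI : injective h.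
  move=> u v; rewrite /h => huv; apply: (@cast_ord_inj _ _ (esym level_sum)).
  move: huv; set u' := cast_ord _ u; set v' := cast_ord _ v => huv.
  (* The block numbers are identified first, since only then do the positions within the blocks have
     a common type. *)
  have e1 : tagnat.sig1 u' = tagnat.sig1 v'.
    by rewrite -(level_indexK (tagnat.sig2 u')) huv level_indexK.
  rewrite -(tagnat.sig2K u') -(tagnat.sig2K v').
  move: (tagnat.sig2 u') (tagnat.sig2 v') huv; rewrite e1 => p q.
  by move/level_index_inj ->.
by exists (perm hI) => u; rewrite permE /h cast_ordK.
Qed.

End LevelEnumeration.

Lemma levels_block_triangular n (x : 'I_n -> 'I_n -> bool) k f g :
  (0 < k)%N -> block_levels x setT setT k f g ->
  block_triangular (\matrix_(i, j) (x i j)%:R).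
Proof.
move=> k0 [fk gk low bl].
pose f' i := Ordinal (fk i (in_setT i)); pose g' i := Ordinal (gk i (in_setT i)).
pose r (t : 'I_k) := #|[set i | f' i == t]|.
have ef (t : 'I_k) : [set i in setT | f i == t :> nat] = [set i | f' i == t].
  by apply/setP => i; rewrite !inE.
have eg (t : 'I_k) : [set i in setT | g i == t :> nat] = [set i | g' i == t].
  by apply/setP => i; rewrite !inE.
have cf t : r t = #|[set i | f' i == t]| by [].
(* Equal row and column counts per level make the diagonal blocks square. *)
have cg t : r t = #|[set i | g' i == t]|.
  by rewrite -eg; have [<- _ _] := bl t (ltn_ord t); rewrite ef.
have [s sE] := level_perm cf; have [t tE] := level_perm cg.
exists (perm_mx s), (perm_mx t^-1%g); rewrite !perm_mx_is_perm; do 2!split=> //.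
exists k; split=> //; exists r, (level_sum cf).
exists (fun u v => \matrix_(p, q) (x (level_index cf p) (level_index cg q))%:R).
split.
- apply/matrixP => i j; rewrite perm_mx_mul_entry invgK castmxE !mxE.
  rewrite -(sE (cast_ord _ i)) -(tE (cast_ord _ j)) cast_ordKV.
  by congr ((x _ (t _))%:R); apply: val_inj.
- move=> u; have [_ r2 ind] := bl u (ltn_ord u); rewrite ef in r2; split=> //.
  apply/(fully_indecomposableP r2 (fun p q => mxE _ _ _ _)).
  apply/(indecomposable_preim x (@level_index_inj _ _ _ _ cf u)
                                  (@level_index_inj _ _ _ _ cg u)).
  by rewrite !level_index_image -ef -eg.
- move=> u v ltvu; apply/matrixP => p q; rewrite !mxE.
  suff /negPf-> : ~~ x (level_index cf p) (level_index cg q) by [].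
  apply: low; rewrite ?in_setT //.
  have /(congr1 val)/= -> := level_indexK cf p.
  by have /(congr1 val)/= -> := level_indexK cg q.
by move=> u v _ p q; rewrite mxE; case: (x _ _); [right | left].
Qed.

(** * The stability number of a bipartite graph *)

Section Alpha.

Variable V : finType.
Implicit Types (e : rel V) (S : {set V}).

Lemma stableP e S :
  reflect (forall x y, x \in S -> y \in S -> ~~ e x y) (stable e S).
Proof. exact: zero_onP. Qed.

Lemma leq_alpha e S : stable e S -> (#|S| <= alpha e)%N.
Proof. by move=> st; rewrite /alpha leq_bigmax_cond. Qed.

Lemma alpha_attained e : exists2 S, stable e S & #|S| = alpha e.
Proof.
have s0 : stable e set0 by apply/stableP => x y; rewrite inE.
have [|S st eS] := @eq_bigmax_cond _ (stable e) (fun S => #|S|).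
  by apply/card_gt0P; exists set0.
by exists S => //; rewrite /alpha eS.
Qed.

Lemma bipartition_disjointF e A B x :
  bipartition e A B -> x \in A -> x \in B = false.
Proof.
by case=> AB0 _ _ xA; apply/negP => xB; have := in_set0 x; rewrite -AB0 inE xA xB.
Qed.

Lemma bipartition_stable e A B : bipartition e A B -> stable e A /\ stable e B.
Proof.
move=> bip; have dAB x : x \in A -> x \in B = false := bipartition_disjointF bip.
case: bip => _ _ eAB; split; apply/stableP => x y xs ys; apply/negP => /eAB.
  by rewrite (dAB x) ?(dAB y) ?andbF.
by case/orP=> /andP[h1 h2]; [rewrite (dAB x) in xs | rewrite (dAB y) in ys].
Qed.

Lemma bipartition_sym e A B : bipartition e A B -> bipartition e B A.
Proof.
by case=> AB0 ABT eAB; split; rewrite 1?setIC 1?setUC // => x y /eAB; rewrite orbC.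
Qed.

(* Maximum stable sets S, T of a bipartite graph form a lattice under
   (S_A :&: T_A, S_B :|: T_B) and (S_A :|: T_A, S_B :&: T_B), so the one with
   the smallest trace on A has its trace contained in all the others. *)
Lemma core_meets_part e A B :
  bipartition e A B -> (#|B| < alpha e)%N ->
  exists2 x, x \in A & forall S, stable e S -> #|S| = alpha e -> x \in S.
Proof.
move=> bip ltB; have dAB x : x \in A -> x \in B = false := bipartition_disjointF bip.
case: bip => AB0 ABT eAB.
have [T0 st0 cT0] := alpha_attained e.
have card_split S1 S2 : S1 \subset A -> S2 \subset B ->
    #|S1 :|: S2| = (#|S1| + #|S2|)%N.
  move=> S1A S2B; rewrite cardsU; suff -> : S1 :&: S2 = set0 by rewrite cards0 subn0.
  by apply/eqP; rewrite -subset0 -AB0 setISS.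
have splitS S : S = (S :&: A) :|: (S :&: B) by rewrite -setIUr ABT setIT.
pose max S := stable e S && (#|S| == alpha e).
have max0 : max T0 by rewrite /max st0 cT0 eqxx.
case: (@arg_minnP _ T0 max (fun S => #|S :&: A|) max0) => T /andP[stT /eqP cT] minT.
(* If the smallest trace were empty, [T] would lie in [B], which has fewer than [alpha e]
   vertices. *)
have [TA0|[x]] := set_0Vmem (T :&: A).
  move: ltB; rewrite -cT [in #|T|](splitS T) TA0 set0U ltnNge.
  by rewrite subset_leq_card ?subsetIr.
rewrite inE => /andP[xT xA]; exists x => // S stS cS.
have stable_mix S1 S2 : S1 \subset A -> S2 \subset B ->
    (forall u v, u \in S1 -> v \in S2 -> ~~ e u v && ~~ e v u) ->
    stable e (S1 :|: S2).
  move=> S1A S2B noe; apply/stableP => u v uS vS; apply/negP => euv.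
  have inS1 w : w \in S1 :|: S2 -> w \in A -> w \in S1.
    rewrite inE => /orP[//|/(subsetP S2B) wB /dAB]; by rewrite wB.
  have inS2 w : w \in S1 :|: S2 -> w \in B -> w \in S2.
    by rewrite inE => /orP[/(subsetP S1A)/dAB->|].
  case/orP: (eAB u v euv) => /andP[uX vX].
    by have := noe u v (inS1 u uS uX) (inS2 v vS vX); rewrite euv.
  by have := noe v u (inS1 v vS vX) (inS2 u uS uX); rewrite euv andbF.
pose W1 := (S :&: T :&: A) :|: ((S :|: T) :&: B).
pose W2 := ((S :|: T) :&: A) :|: (S :&: T :&: B).
have stW1 : stable e W1.
  apply: stable_mix; rewrite ?subsetIr // => u v.
  rewrite !inE => /andP[/andP[uS uT] _] /andP[/orP[vS|vT] _].
    by rewrite !(stableP _ _ stS).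
  by rewrite !(stableP _ _ stT).
have stW2 : stable e W2.
  apply: stable_mix; rewrite ?subsetIr // => u v.
  rewrite !inE => /andP[/orP[uS|uT] _] /andP[/andP[vS vT] _].
    by rewrite !(stableP _ _ stS).
  by rewrite !(stableP _ _ stT).
(* The sizes of [W1] and [W2] sum to [#|S| + #|T|], twice [alpha e], and neither exceeds
   [alpha e]. *)
have cW1 : #|W1| = alpha e.
  have := leq_alpha stW1; have := leq_alpha stW2.
  have sub C : S :&: T :&: C = (S :&: C) :&: (T :&: C).
    by rewrite setIACA setIid.
  have := cardsUI (S :&: A) (T :&: A); have := cardsUI (S :&: B) (T :&: B).
  have := card_split _ _ (subsetIr S A) (subsetIr S B); rewrite -splitS cS.
  have := card_split _ _ (subsetIr T A) (subsetIr T B); rewrite -splitS cT.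
  rewrite [#|W1|]card_split ?subsetIr // [#|W2|]card_split ?subsetIr //.
  by rewrite !sub !setIUl; lia.
have := minT W1; rewrite /max stW1 cW1 eqxx => /(_ isT) le.
have W1A : W1 :&: A = S :&: T :&: A.
  apply/setP => u; rewrite !inE.
  by have [uA|] := boolP (u \in A); rewrite ?andbF // dAB // !andbT andbF orbF.
(* The trace of [W1] is contained in that of [T] and, by minimality, no smaller. *)
have /eqP eTA : S :&: T :&: A == T :&: A.
  by rewrite eqEcard -W1A le andbT W1A setSI ?subsetIr.
have : x \in T :&: A by rewrite inE xT.
by rewrite -eTA !inE => /andP[/andP[]].
Qed.

Lemma alpha_plus_stable_leq e A B :
  bipartition e A B -> #|A| = #|B| -> alpha_plus_stable e -> (alpha e <= #|A|)%N.
Proof.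
move=> bip cAB plus; rewrite leqNgt; apply/negP => ltA.
have [|x xA xcore] := core_meets_part bip; first by rewrite -cAB.
have [y yB ycore] := core_meets_part (bipartition_sym bip) ltA.
have xy : x != y by apply: contraFneq (bipartition_disjointF bip xA) => ->.
have [S0 st0 cS0] := alpha_attained e.
have nexy : ~~ e x y by apply: (stableP _ _ st0); [apply: xcore | apply: ycore].
have [S /stableP st cS] := alpha_attained (add_edge e x y).
(* As [S] is stable in [e] too and [plus] gives it size [alpha e], it contains both [x] and [y],
   which the new edge forbids. *)
have stS : stable e S.
  by apply/stableP => u v uS vS; have := st u v uS vS; rewrite negb_or => /andP[].
rewrite plus // in cS.
by have := st x y (xcore S stS cS) (ycore S stS cS); rewrite /add_edge /= eqxx orbT.
Qed.

Lemma alpha_ge_part e A B : bipartition e A B -> (#|A| <= alpha e)%N.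
Proof. by move=> /bipartition_stable[/leq_alpha]. Qed.

Lemma bipartition_del e A B x y : bipartition e A B -> bipartition (del_edge e x y) A B.
Proof. by case=> ? ? eAB; split=> // u v /andP[/eAB]. Qed.

(** A new edge cannot have both ends in [A] and both ends in [B], so one part stays stable; its size
    already reaches [alpha e]. *)
Lemma bipartite_alpha_plus_stable e A B :
  bipartition e A B -> #|A| = #|B| -> (alpha e <= #|A|)%N -> alpha_plus_stable e.
Proof.
move=> bip cAB le x y xy _; apply/eqP; rewrite eqn_leq; apply/andP; split.
  have [S /stableP st <-] := alpha_attained (add_edge e x y); apply: leq_alpha.
  by apply/stableP => u v uS vS; have := st u v uS vS; rewrite negb_or => /andP[].
apply: leq_trans le _; have [/stableP stA /stableP stB] := bipartition_stable bip.
have add_stable (C : {set V}) : ~~ ((x \in C) && (y \in C)) ->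
    (forall u v, u \in C -> v \in C -> ~~ e u v) -> stable (add_edge e x y) C.
  move=> nxy st; apply/stableP => u v uC vC; rewrite /add_edge /= negb_or st //=.
  apply: contra nxy => /eqP euv; apply/andP.
  have sub w : w \in [set x; y] -> w \in C.
    by rewrite -euv !inE => /orP[/eqP->|/eqP->].
  by split; apply: sub; rewrite !inE eqxx ?orbT.
have [/andP[xA yA]|nxy] := boolP ((x \in A) && (y \in A)).
  by rewrite cAB; apply/leq_alpha/add_stable; rewrite ?(bipartition_disjointF bip xA).
exact/leq_alpha/add_stable.
Qed.

End Alpha.

(** * Stable sets as zero submatrices of the reduced adjacency matrix *)

Section ReducedAdjacency.

Variables (V : finType) (A B : {set V}) (n : nat) (a b : 'I_n -> V).
Hypotheses (enum_a : enumerates a A) (enum_b : enumerates b B).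
Implicit Types (e : rel V) (I J : {set 'I_n}).

Lemma enumerates_in m (c : 'I_m -> V) C i : enumerates c C -> c i \in C.
Proof. by case=> _ <-; apply: imset_f. Qed.

Lemma enumerates_card m (c : 'I_m -> V) C : enumerates c C -> #|C| = m.
Proof. by case=> cI <-; rewrite card_imset // card_ord. Qed.

Lemma enumerates_preim m (c : 'I_m -> V) C (S : {set V}) :
  enumerates c C -> #|c @^-1: S| = #|S :&: C|.
Proof.
case=> cI eC; rewrite -(card_imset _ cI); apply: eq_card => u.
rewrite inE -eC; apply/imsetP/andP => [[i]|[uS /imsetP[i _ ui]]].
  by rewrite inE => iS ->; rewrite iS imset_f.
by exists i; rewrite // inE -ui.
Qed.

(* [S |-> (a @^-1: S, b @^-1: S)] turns stable sets into zero submatrices. *)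
Lemma bipartite_alpha_leqP e m : symmetric e -> bipartition e A B ->
  (alpha e <= m)%N <->
  forall I J, zero_on (fun i j => e (a i) (b j)) I J -> (#|I| + #|J| <= m)%N.
Proof.
move=> sym bip; have [AB0 ABT eAB] := bip; split=> [le I J /zero_onP z|le].
  apply: leq_trans le.
  have <- : #|a @: I :|: b @: J| = (#|I| + #|J|)%N.
    case: (enum_a) (enum_b) => aI eA [bI eB].
    rewrite cardsU !card_imset //; suff -> : a @: I :&: b @: J = set0.
      by rewrite cards0 subn0.
    by apply/eqP; rewrite -subset0 -AB0 -eA -eB setISS // imsetS //; apply/subsetP.
  have [/stableP stA /stableP stB] := bipartition_stable bip.
  apply/leq_alpha/stableP => u v; rewrite !inE.
  case/orP=> /imsetP[i iI ->] /orP[]/imsetP[j jJ ->]; rewrite ?z //.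
  - by apply: stA; apply: enumerates_in enum_a.
  - by rewrite sym z.
  by apply: stB; apply: enumerates_in enum_b.
have [S /stableP st <-] := alpha_attained e.
have -> : #|S| = (#|a @^-1: S| + #|b @^-1: S|)%N.
  rewrite (enumerates_preim _ enum_a) (enumerates_preim _ enum_b).
  rewrite -cardsUI setIACA AB0 setI0 cards0 addn0.
  by rewrite -setIUr ABT setIT.
by apply: le; apply/zero_onP => i j; rewrite !inE; apply: st.
Qed.

(** A sparse [I] x [J] is a zero submatrix either of the graph or of the graph with one edge
    deleted, so robustness bounds the stability numbers of all these graphs by [#|A|] at once. *)
Lemma alpha_stable_robust e : simple_graph e -> bipartition e A B ->
  alpha_stable e <-> robust (fun i j => e (a i) (b j)) setT setT.
Proof.
move=> simple bip; have cA := enumerates_card enum_a.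
have cAB : #|A| = #|B| by rewrite cA (enumerates_card enum_b).
have cT : #|[set: 'I_n]| = #|A| by rewrite cardsT card_ord.
have [aI _] := enum_a; have [bI _] := enum_b.
have nab i j : (a i == b j) = false.
  apply: contraFF (bipartition_disjointF bip (enumerates_in i enum_a)) => /eqP->.
  exact: enumerates_in enum_b.
have edgeK i j i' j' : [set a i; b j] = [set a i'; b j'] -> i = i' /\ j = j'.
  move=> eq; have : a i \in [set a i'; b j'] by rewrite -eq !inE eqxx.
  have : b j \in [set a i'; b j'] by rewrite -eq !inE eqxx orbT.
  by rewrite !inE nab orbF eq_sym nab => /eqP/bI -> /eqP/aI ->.
have sym_del x y : symmetric (del_edge e x y) by case: (del_edge_simple x y simple).
have [sym _] := simple; split=> [[minus plus] I J _ _ sp | rob].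
  have le := alpha_plus_stable_leq bip cAB plus; rewrite cT.
  have [z|nz] := boolP (zero_on (fun i j => e (a i) (b j)) I J).
    by have /(bipartite_alpha_leqP _ sym bip) := le; apply.
  move: nz; rewrite negb_forall => /existsP[i]; rewrite negb_imply => /andP[iI].
  rewrite negb_forall => /existsP[j]; rewrite negb_imply negbK => /andP[jJ eij].
  (* Deleting the only edge met by [I] x [J] makes it a zero submatrix, and [minus] carries the
     bound over to the smaller graph. *)
  rewrite -(minus _ _ eij) in le.
  have := (bipartite_alpha_leqP _ (sym_del _ _) (bipartition_del _ _ bip)).1 le I J.
  apply; apply/zero_onP => i' j' i'I j'J; apply/negP => /andP[eij' /negP[]].
  by have [-> ->] := sp _ _ _ _ i'I j'J iI jJ eij' eij.
have le : (alpha e <= #|A|)%N.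
  apply/(bipartite_alpha_leqP _ sym bip) => I J z; rewrite -cT.
  by apply: rob; rewrite ?subsetT //; apply: zero_on_sparse.
split; last exact: bipartite_alpha_plus_stable bip cAB le.
move=> x y exy; have bipd := bipartition_del x y bip.
(* [A] is stable before and after the deletion, so both stability numbers are at least [#|A|] and
   only an upper bound remains. *)
have ge := alpha_ge_part bip; have ged := alpha_ge_part bipd.
suff : (alpha (del_edge e x y) <= #|A|)%N by lia.
apply/(bipartite_alpha_leqP _ (sym_del _ _) bipd) => I J /zero_onP z; rewrite -cT.
apply: rob; rewrite ?subsetT // => i j i' j' iI jJ i'I j'J eij eij'.
(* An edge of [e] inside [I] x [J] must be the deleted one, so any two of them have the same ends
   and, by [edgeK], the same indices. *)
have := z i j iI jJ; have := z i' j' i'I j'J.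
rewrite /del_edge /= eij eij' /= !negbK => /eqP <- /eqP; exact: edgeK.
Qed.

End ReducedAdjacency.

Theorem theorem5 (V : finType) (e : rel V) (A B : {set V}) (n : nat)
    (a b : 'I_n -> V)
    (simple_e : simple_graph e) (bip : bipartition e A B)
    (balanced : #|A| = #|B|)
    (n_gt0 : (0 < n)%N) (card_V : #|V| = (2 * n)%N)
    (enum_a : enumerates a A) (enum_b : enumerates b B) :
  alpha_stable e <->
  exists P Q : 'M[int]_n, is_perm_mx P /\ is_perm_mx Q /\
  exists k : nat, (1 <= k)%N /\
  exists (r : 'I_k -> nat) (sum_r : (\sum_(i < k) r i)%N = n)
         (Y : forall i j : 'I_k, 'M[int]_(r i, r j)),
    [/\ P *m reduced_adjacency e a b *m Q =
          castmx (sum_r, sum_r) (\mxblock_(i < k, j < k) Y i j),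
        forall i : 'I_k, (2 <= r i)%N /\ fully_indecomposable (Y i i),
        forall i j : 'I_k, (j < i)%N -> Y i j = 0 &
        forall i j : 'I_k, (i < j)%N -> zero_one_mx (Y i j)].
Proof.
apply: iff_trans (alpha_stable_robust enum_a enum_b simple_e bip) _.
split=> [rob|].
  have [||k [f [g [k0 lev]]]] := robust_block_levels _ _ rob.
  - by [].
  - by rewrite cardsT card_ord.
  exact: levels_block_triangular k0 lev.
by case/block_triangular_levels=> k [f [g /block_levels_robust]].
Qed.
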